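(* Let $d\in\mathbb N$ and let $G\subset\mathbb R^d$ be a closed symmetric convex body. Define $$c(G):=\inf\{t>0: Q_{1/2}\subseteq tG\},\qquad Q_{1/2}=[-1/2,1/2]^d .$$ Then for every $p\in(1,\infty)$ the inequality $$\Big\|\sup_{t\ge c(G)d}|\mathcal M_t^Gf|\Big\|_{\ell^p(\mathbb Z^d)}\le e^6\,\big\|M_*^G\big\|_{L^p(\mathbb R^d)\to L^p(\mathbb R^d)}\,\|f\|_{\ell^p(\mathbb Z^d)}$$ holds for all $f\in\ell^p(\mathbb Z^d)$.
   Context: A symmetric convex body is a bounded, closed, symmetric ($G=-G$) convex subset $G$ of $\mathbb R^d$ with non-empty interior. For $t>0$ put $G_t=\{y\in\mathbb R^d: t^{-1}y\in G\}$. Discrete averages: for $f:\mathbb Z^d\to\mathbb C$ and $x\in\mathbb Z^d$, $$\mathcal M_t^Gf(x)=\frac{1}{|G_t\cap\mathbb Z^d|}\sum_{y\in G_t\cap\mathbb Z^d}f(x-y),$$ where $|G_t\cap\mathbb Z^d|$ is the number of elements of $G_t\cap\mathbb Z^d$. Continuous averages: for $F\in L^1_{\rm loc}(\mathbb R^d)$ and $x\in\mathbb R^d$, $$M_t^GF(x)=\frac1{|G_t|}\int_{G_t}F(x-y)\,dy,$$ where $|G_t|$ is Lebesgue measure, and $M_*^GF=\sup_{t>0}|M_t^GF|$. The operator norm is $\|M_*^G\|_{L^p\to L^p}=\sup_{\|F\|_{L^p}\le1}\|M_*^GF\|_{L^p}$. *)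

(* Defs.v *)
From HB Require Import structures.
From mathcomp Require Import all_boot all_order all_algebra.
From mathcomp Require Import all_classical all_reals all_analysis.
From mathcomp Require Import finmap complex.
Set Implicit Arguments.
Unset Strict Implicit.
Unset Printing Implicit Defensive.
Import Order.TTheory GRing.Theory Num.Theory.
Import numFieldNormedType.Exports.
Local Open Scope classical_set_scope.
Local Open Scope ring_scope.

Section measurable_rV.
Variables (R : realType) (n : nat).

Let coord (i : 'I_n) (x : 'rV[R]_n) : measurableTypeR R := x ord0 i.

Let rV_set0 : g_sigma_preimage coord set0.
Proof. exact: sigma_algebra0. Qed.

Let rV_setC A : g_sigma_preimage coord A -> g_sigma_preimage coord (~` A).
Proof. exact: sigma_algebraC. Qed.

Let rV_bigcup (F : (set 'rV[R]_n)^nat) :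
  (forall i, g_sigma_preimage coord (F i)) ->
  g_sigma_preimage coord (\bigcup_i (F i)).
Proof. exact: sigma_algebra_bigcup. Qed.

(* The sigma-algebra generated by the coordinate maps, i.e. the Borel
   sigma-algebra of R^n; it is built as the one on n.-tuple. *)
HB.instance Definition _ := @isMeasurable.Build default_measure_display
  'rV[R]_n (g_sigma_preimage coord) rV_set0 rV_setC rV_bigcup.

End measurable_rV.

Section measurable_cons.
Variables (R : realType).

Lemma measurable_coord n (i : 'I_n) :
  measurable_fun [set: 'rV[R]_n] (fun x => x ord0 i : measurableTypeR R).
Proof.
move=> _ Y mY; rewrite setTI; apply: sub_sigma_algebra => /=.
rewrite -bigcup_seq/=; exists i => /=; first by rewrite mem_index_enum.
by exists Y => //; rewrite setTI.
Qed.

Lemma measurable_fun_rVP d (T : measurableType d) n (f : T -> 'rV[R]_n) :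
  (forall i, measurable_fun [set: T] (fun t => f t ord0 i : measurableTypeR R)) ->
  measurable_fun [set: T] f.
Proof.
move=> mf _ A mA; rewrite setTI.
pose S := image_set_system setT f measurable.
suff : S A by rewrite /S /image_set_system /= setTI.
apply: mA; split; first exact/sigma_algebra_image/sigma_algebra_measurable.
rewrite -bigcup_seq/=; apply: bigcup_sub => i _ B [C mC <-].
rewrite /S /image_set_system /= !setTI.
by have := mf i measurableT C mC; rewrite setTI.
Qed.

Definition rV_cons n (p : measurableTypeR R * 'rV[R]_n) : 'rV[R]_n.+1 :=
  \row_i (if unlift ord0 i is Some j then p.2 ord0 j else p.1).

Definition rV_uncons n (v : 'rV[R]_n.+1) : measurableTypeR R * 'rV[R]_n :=
  (v ord0 ord0, \row_i v ord0 (lift ord0 i)).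

Lemma rV_uncons_consK n : cancel (@rV_uncons n) (@rV_cons n).
Proof.
move=> v; apply/rowP => i; rewrite mxE.
by case: (unliftP ord0 i) => [j|] -> /=; rewrite ?mxE.
Qed.

Lemma rV_consK n : cancel (@rV_cons n) (@rV_uncons n).
Proof.
move=> [a v]; rewrite /rV_uncons mxE unlift_none; congr (_, _).
by apply/rowP => i; rewrite !mxE liftK.
Qed.

Lemma measurable_rV_cons n : measurable_fun setT (@rV_cons n).
Proof.
apply: measurable_fun_rVP => i; under eq_fun do rewrite mxE.
case: (unliftP ord0 i) => [j|] _ /=; last exact: measurable_fst.
by apply: (measurableT_comp (measurable_coord j)); exact: measurable_snd.
Qed.

Lemma measurable_rV_uncons n : measurable_fun setT (@rV_uncons n).
Proof.
apply: measurable_fun_pair; first exact: measurable_coord.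
apply: measurable_fun_rVP => i; under eq_fun do rewrite mxE.
exact: measurable_coord.
Qed.

End measurable_cons.

Section lebesgue_rV.
Variable R : realType.

Section step.
Variables (n : nat) (mu : {sigma_finite_measure set 'rV[R]_n -> \bar R}).

Definition lebesgue_rV_step : set 'rV[R]_n.+1 -> \bar R :=
  pushforward (lebesgue_measure \x mu)%E (@rV_cons R n).

Let step0 : lebesgue_rV_step set0 = 0%E.
Proof. by rewrite /lebesgue_rV_step /pushforward preimage_set0 measure0. Qed.

Let step_ge0 A : (0 <= lebesgue_rV_step A)%E.
Proof. exact: (measure_ge0 (lebesgue_measure \x mu)%E). Qed.

Let step_sigma_additive : semi_sigma_additive lebesgue_rV_step.
Proof.
exact: (@measure_semi_sigma_additive _ _ _
  (measure_function_pushforward__canonical__measure_function_Measure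
    _ (@measurable_rV_cons R n))).
Qed.

HB.instance Definition _ := isMeasure.Build _ _ _ lebesgue_rV_step
  step0 step_ge0 step_sigma_additive.

Let sigma_finite_step : sigma_finite setT lebesgue_rV_step.
Proof.
have /sigma_finiteP[F [TF ndF Foo]] :=
  sigma_finiteT (@lebesgue_measure R : {sigma_finite_measure set _ -> \bar R}).
have /sigma_finiteP[G [TG ndG Goo]] := sigma_finiteT mu.
exists (fun k => @rV_uncons R n @^-1` (F k `*` G k)).
  rewrite -preimage_bigcup [X in _ @^-1` X](_ : _ = setT) ?preimage_setT//.
  rewrite -subTset => -[x y] _.
  have [k _ Fkx] : (\bigcup_k F k) x by rewrite -TF.
  have [l _ Gly] : (\bigcup_k G k) y by rewrite -TG.
  exists (maxn k l) => //; split => /=.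
    by move: x Fkx; exact/subsetPset/ndF/leq_maxl.
  by move: y Gly; exact/subsetPset/ndG/leq_maxr.
move=> k; have [mF Fk] := Foo k; have [mG Gk] := Goo k; split.
  rewrite -[X in measurable X]setTI; apply: measurable_rV_uncons => //.
  exact: measurableX.
rewrite /lebesgue_rV_step /pushforward -comp_preimage.
rewrite (_ : _ \o _ = id); last by apply/funext => p /=; rewrite rV_consK.
by rewrite preimage_id product_measure1E// lte_mul_pinfty// ge0_fin_numE.
Qed.

HB.instance Definition _ := Measure_isSigmaFinite.Build _ _ _
  lebesgue_rV_step sigma_finite_step.

End step.

(* d-dimensional Lebesgue measure, as the d-fold product of the
   one-dimensional one; R^0 is a point of mass 1. *)
Fixpoint lebesgue_rV n : {sigma_finite_measure set 'rV[R]_n -> \bar R} :=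
  if n is m.+1 then lebesgue_rV_step (lebesgue_rV m) else \d_(0 : 'rV[R]_0).

End lebesgue_rV.
Arguments lebesgue_rV {R} n.

Local Open Scope complex_scope.

Section averages.
Variable R : realType.
Implicit Types (t p : R) (d : nat).

Definition cabs T (f : T -> R[i]) : T -> \bar R :=
  fun x => (Normc.normc (f x))%:E.

Record symmetric_convex_body d (G : set 'rV[R]_d) : Prop := {
  scb_bounded : bounded_set G;
  scb_closed : closed G;
  scb_convex : convex_set G;
  scb_symmetric : [set - y | y in G] = G;
  scb_interior : G° !=set0 }.

Definition dilate d t (G : set 'rV[R]_d) : set 'rV[R]_d :=
  [set y | G (t^-1 *: y)].

Definition Q_half d : set 'rV[R]_d :=
  [set x | forall i, `|x ord0 i| <= 2^-1].

Definition c_body d (G : set 'rV[R]_d) : R :=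
  inf [set t | 0 < t /\ @Q_half d `<=` [set t *: y | y in G]].

Definition lattice_dilate d t (G : set 'rV[R]_d) : set 'rV[int]_d :=
  [set y | dilate t G (map_mx intr y)].

(* For a bounded G and t > 0 the set lattice_dilate t G is finite, which is
   what makes fset_set and the finitely supported sum the intended ones. *)
Definition discrete_avg d (G : set 'rV[R]_d) t (f : 'rV[int]_d -> R[i])
    (x : 'rV[int]_d) : R[i] :=
  ((#|` fset_set (lattice_dilate t G)|)%:R)^-1 *
  \sum_(y \in lattice_dilate t G) f (x - y).

Definition discrete_maximal_from d (G : set 'rV[R]_d) (t0 : R)
    (f : 'rV[int]_d -> R[i]) (x : 'rV[int]_d) : \bar R :=
  ereal_sup [set cabs (discrete_avg G t f) x | t in [set t | t0 <= t]].

Definition ell_norm d p (g : 'rV[int]_d -> \bar R) : \bar R :=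
  ((\esum_(x in [set: 'rV[int]_d]) `|g x| `^ p) `^ p^-1)%E.

Definition complex_integral d (D : set 'rV[R]_d) (F : 'rV[R]_d -> R[i]) : R[i] :=
  (\int[lebesgue_rV d]_(y in D) complex.Re (F y)) +i*
  (\int[lebesgue_rV d]_(y in D) complex.Im (F y)).

Definition continuous_avg d (G : set 'rV[R]_d) t (F : 'rV[R]_d -> R[i])
    (x : 'rV[R]_d) : R[i] :=
  ((fine (lebesgue_rV d (dilate t G)))^-1)%:C *
  complex_integral (dilate t G) (fun y => F (x - y)).

Definition continuous_maximal d (G : set 'rV[R]_d) (F : 'rV[R]_d -> R[i])
    (x : 'rV[R]_d) : \bar R :=
  ereal_sup [set cabs (continuous_avg G t F) x | t in [set t | 0 < t]].

Definition complex_measurable d (F : 'rV[R]_d -> R[i]) : Prop :=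
  measurable_fun setT (fun x => complex.Re (F x)) /\
  measurable_fun setT (fun x => complex.Im (F x)).

(* Borel representatives of the classes in the unit ball of L^p suffice:
   the averages only see F up to null sets. *)
Definition maximal_opnorm d (G : set 'rV[R]_d) p : \bar R :=
  ereal_sup [set ('N[lebesgue_rV d]_(p%:E)[continuous_maximal G F])%E | F in
    [set F | complex_measurable F /\
      ('N[lebesgue_rV d]_(p%:E)[cabs F] <= 1)%E]].

End averages.

(* Main.v *)
Require Import Defs.
From mathcomp Require Import all_boot all_order all_algebra.
From mathcomp Require Import finmap.
From mathcomp Require Import all_classical all_reals all_analysis.
From mathcomp Require Import measurable_realfun.
From mathcomp Require Import complex.
From mathcomp Require Import zify ring lra.
Set Implicit Arguments.
Unset Strict Implicit.
Unset Printing Implicit Defensive.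
Import Order.TTheory GRing.Theory Num.Theory.
Import numFieldNormedType.Exports.
Local Open Scope classical_set_scope.
Local Open Scope ring_scope.

(** The discrete averages are compared with continuous ones through the step
    function F that takes the value |f(z)| on the unit cell of points rounding
    to the lattice point z. Cells have volume 1, so F and f have equal L^p and
    l^p norms ([Lnorm_comp_lround]), and it suffices to bound, for every u in
    the cell of x, the discrete average at x by e^6 times a continuous average
    of F at u.

    Write c = c(G). Closedness of G makes the infimum defining c a minimum: the
    unit cube Q is contained in cG ([Q_half_sub_dilate_c]). For y in G_t the
    points w with u - w in the cell of x - y differ from y by a sum of two
    vectors of Q, so by convexity they lie in G_(t+2c). Summing over y,
        sum_(y in G_t) |f(x - y)| <= int_(G_(t+2c)) F(u - w) dw
    ([lattice_sum_le_integral]). In the other direction, rounding moves a point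
    by a vector of Q, so G_(t-c) is covered by the cells of the lattice points
    of G_t, and their number N is at least |G_(t-c)|
    ([volume_le_lattice_count]). Since volume is homogeneous of degree d,
        |G_(t+2c)| / N <= ((t+2c)/(t-c))^d = (1 + 3c/(t-c))^d,
    and t >= cd with d >= 2 bounds this by exp(3d/(d-1)) <= e^6. In dimension
    one that exponent is infinite when t = c, but there cG is exactly Q, which
    gives |G_(t+2c)| <= 4 <= 4N for t <= 2c, and the ratio above is at most 4
    for t >= 2c ([volume_dilate_le_lattice_count]).

    Hence the discrete maximal function, composed with rounding, is at most
    e^6 M_*F pointwise ([discrete_maximal_le_continuous]); taking norms, after
    scaling f to norm 1 so that F competes in the supremum defining the
    operator norm, concludes. The maximal function M_*F enters only as an upper
    bound under an integral, where monotonicity holds without measurability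
    ([ge0_le_integral_fun]). *)

(** * Volume of boxes and dilates *)

Section volume.
Variable R : realType.

Lemma measurable_box n (I : 'I_n -> set (measurableTypeR R)) :
  (forall i, measurable (I i)) ->
  measurable [set u : 'rV[R]_n | forall i, I i (u ord0 i)].
Proof.
move=> mI; rewrite [X in measurable X](_ : _ =
  \bigcap_(i in setT)
    ((fun u : 'rV[R]_n => u ord0 i : measurableTypeR R) @^-1` I i)).
  apply: fin_bigcap_measurable; first exact: finite_finset.
  move=> i _; rewrite -[X in measurable X]setTI.
  exact: (@measurable_coord R n i measurableT _ (mI i)).
by apply/seteqP; split => [u h i _|u h i]; [exact: h|exact: (h i)].
Qed.

Lemma lebesgue_rV_box n (I : 'I_n -> set (measurableTypeR R)) :
  (forall i, measurable (I i)) ->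
  lebesgue_rV n [set u : 'rV[R]_n | forall i, I i (u ord0 i)]
  = (\prod_(i < n) lebesgue_measure (I i))%E.
Proof.
elim: n I => [|n IH] I mI.
  by rewrite /= diracE big_ord0 mem_set// => -[].
rewrite big_ord_recl -IH// -product_measure1E//; last first.
  exact: (@measurable_box n (fun i => I (lift ord0 i)) (fun i => mI _)).
rewrite /= /lebesgue_rV_step /pushforward; congr (_ _).
apply/seteqP; split => [[x u] /= h|[x u] /= [h0 h] i].
  split; first by have := h ord0; rewrite mxE unlift_none.
  by move=> i; have := h (lift ord0 i); rewrite mxE liftK.
by rewrite mxE; case: unliftP => [j|] ->.
Qed.

(** Both sides agree for indicators of intervals; the uniqueness of Lebesgue
    measure on intervals extends this to all Borel sets. *)
Lemma ge0_integral_scale (t : R) (g : R -> \bar R) : 0 < t ->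
  measurable_fun setT g -> (forall x, 0 <= g x)%E ->
  (\int[lebesgue_measure]_x g (t^-1 * x)%R =
   t%:E * \int[lebesgue_measure]_x g x)%E.
Proof.
move=> t0 mg g0.
have ti0 : 0 < t^-1 by rewrite invr_gt0.
pose phi : measurableTypeR R -> measurableTypeR R := fun x => t^-1 * x.
have mphi : measurable_fun setT phi by exact: mulrl_measurable.
pose nu : {measure set (measurableTypeR R) -> \bar R} :=
  measure_function_pushforward__canonical__measure_function_Measure
    lebesgue_measure mphi.
pose k : {nonneg R} := NngNum (ltW ti0).
have E A : measurable A ->
    lebesgue_measure A = mscale k nu A.
  apply: lebesgue_measure_unique => _ [[a b]] _ <- /=.
  rewrite /mscale /pushforward /=.
  rewrite [X in (_ * lebesgue_measure X)%E](_ : _ = `]t * a, t * b]%classic);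
    last first.
    apply/seteqP; split => x; rewrite /phi /= !in_itv/=;
    by rewrite ltr_pdivlMl// ler_pdivrMl.
  rewrite !lebesgue_measure_itv/= !lte_fin ltr_pM2l//; case: ifPn => _.
    by rewrite -!EFinB -EFinM -mulrBr mulKf ?gt_eqF.
  by rewrite mule0.
have -> : (\int[lebesgue_measure]_x g x =
  \int[mscale k nu]_x g x)%E.
  by apply: eq_measure_integral => // A mA _; exact: E.
rewrite ge0_integral_mscale//= muleA -EFinM divff ?gt_eqF// mul1e.
by rewrite ge0_integral_pushforward.
Qed.

Lemma measurable_dilate_rV n (t : R) (A : set 'rV[R]_n) :
  measurable A -> measurable (dilate t A).
Proof.
move=> mA.
suff m : measurable_fun setT (fun u : 'rV[R]_n => t^-1 *: u).
  by rewrite -[X in measurable X]setTI; exact: m.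
apply: measurable_fun_rVP => i; under eq_fun do rewrite mxE.
apply: (measurableT_comp (mulrl_measurable _)).
exact: (@measurable_coord R n i).
Qed.

(** By induction on the dimension: the slice of tA at height x is the dilate by
    t of the slice of A at height x/t, and the substitution x -> x/t in the
    outer integral provides the remaining factor t. *)
Lemma lebesgue_rV_dilate n (t : R) (A : set 'rV[R]_n) : 0 < t ->
  measurable A ->
  lebesgue_rV n (dilate t A) = ((t ^+ n)%:E * lebesgue_rV n A)%E.
Proof.
move=> t0; elim: n A => [|n IH] A mA.
  rewrite expr0 mul1e /= !diracE; congr (_%:R%:E); congr (nat_of_bool _).
  by apply/idP/idP => /set_mem h; apply/mem_set; move: h;
    rewrite /dilate /= scaler0.
pose B := @rV_cons R n @^-1` A.
have mB : measurable B.
  by rewrite -[X in measurable X]setTI; exact: measurable_rV_cons.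
rewrite /= /lebesgue_rV_step /pushforward /product_measure1/=.
transitivity (\int[lebesgue_measure]_x
  ((t ^+ n)%:E * (lebesgue_rV n \o xsection B) (t^-1 * x)%R))%E.
  apply: eq_integral => x _ /=.
  rewrite -IH; last exact: measurable_xsection.
  have E u : t^-1 *: rV_cons (x, u) = rV_cons (t^-1 * x, t^-1 *: u).
    by apply/rowP => i; rewrite !mxE; case: unliftP => //= j; rewrite !mxE.
  congr (_ _); rewrite /xsection /dilate; apply/seteqP.
  by split => u /= /set_mem h; apply/mem_set; move: h; rewrite /B/= -E.
have mg : measurable_fun setT (lebesgue_rV n \o xsection B).
  exact: measurable_fun_xsection.
have tn : (0 <= t ^+ n)%R by rewrite exprn_ge0 ?ltW.
rewrite ge0_integralZl//.
  by rewrite ge0_integral_scale// exprSr EFinM muleA.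
apply: (measurableT_comp mg); exact: mulrl_measurable.
Qed.

End volume.

(** * Integrals of step functions over lattice cells *)

Section fibres.
Context d (T : measurableType d) (R : realType).
Variable mu : {measure set T -> \bar R}.
Variables (Z : countType) (phi : T -> Z).
Hypothesis mphi : forall z, measurable (phi @^-1` [set z]).

Lemma measurable_preimage_countable (A : set Z) : measurable (phi @^-1` A).
Proof.
rewrite [X in measurable X](_ : _ = \bigcup_(z in A) (phi @^-1` [set z])).
  rewrite bigcup_mkcond; apply: countable_bigcupT_measurable => // z.
  by case: ifPn => // _; exact: mphi.
by apply/seteqP; split => [u ?|u [z Az /= ->//]]; exists (phi u).
Qed.

Lemma measurable_comp_countable d' (U : measurableType d') (h : Z -> U) :
  measurable_fun setT (h \o phi).
Proof.
move=> _ Y mY; rewrite setTI comp_preimage.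
exact: measurable_preimage_countable.
Qed.

(** The domain is partitioned into the pieces on which the integrand is
    constant. This single formula yields the norms of step functions, the
    lower bound for averages of step functions and the volume bound for
    lattice point counts. *)
Lemma ge0_integral_comp_countable (D : set T) (h : Z -> \bar R) :
  measurable D -> (forall z, 0 <= h z)%E ->
  (\int[mu]_(u in D) h (phi u) =
   \esum_(z in [set: Z]) (h z * mu (D `&` phi @^-1` [set z])))%E.
Proof.
move=> mD h0.
(* The countable range is numbered so that the pieces form a sequence. *)
pose F n := D `&` [set u | choice.pickle (phi u) = n].
have mF n : measurable (F n).
  apply: measurableI => //.
  exact: (measurable_preimage_countable [set z | choice.pickle z = n]).
have DF : D = \bigcup_n F n.
  by apply/seteqP; split => [u Du|u [n _ []]//]; exists (choice.pickle (phi u)).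
have Fz z : F (choice.pickle z) = D `&` phi @^-1` [set z].
  apply/seteqP; split => u [Du /= e]; split => //=; last by rewrite e.
  exact: (pcan_inj choice.pickleK).
have intF z : (\int[mu]_(u in F (choice.pickle z)) h (phi u) =
    h z * mu (D `&` phi @^-1` [set z]))%E.
  rewrite (eq_integral (cst (h z))); last first.
    by move=> u /set_mem; rewrite Fz => -[_ /= ->].
  by rewrite integral_cst// Fz.
have tF : trivIset setT F by move=> i j _ _ [u [[_ <-] [_ <-]]].
transitivity (\int[mu]_(u in \bigcup_n F n) h (phi u))%E; first by rewrite -DF.
rewrite ge0_integral_bigcup//; last first.
  by apply: measurable_funTS; exact: measurable_comp_countable.
rewrite nneseries_esumT; last by move=> n; exact: integral_ge0.
transitivity (\esum_(n in range (@choice.pickle Z)) \int[mu]_(u in F n) h (phi u))%E.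
  rewrite [RHS]esum_mkcond; apply: eq_esum => n _.
  case: ifPn => // /negP nz; suff -> : F n = set0 by rewrite integral_set0.
  by rewrite -subset0 => u [_ /= e]; apply: nz; apply/mem_set; exists (phi u).
rewrite esum_image; first by apply: eq_esum => z _; exact: intF.
by move=> a b _ _; exact: (pcan_inj choice.pickleK).
Qed.

End fibres.

Section rounding.
Variables (R : realType) (n : nat).

(** Adding 1/2 before taking the floor makes the cells half-open cubes centred
    at the lattice points. *)
Definition lround (u : 'rV[R]_n) : 'rV[int]_n :=
  \row_i Num.floor (u ord0 i + 2^-1).

Lemma lroundP (u : 'rV[R]_n) (z : 'rV[int]_n) : lround u = z <->
  forall i, (z ord0 i)%:~R - 2^-1 <= u ord0 i < (z ord0 i)%:~R + 2^-1.
Proof.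
split => [<- i|h].
  rewrite mxE; have := floor_itv (u ord0 i + 2^-1).
  by rewrite intrD => /andP[h1 h2]; apply/andP; split; lra.
apply/rowP => i; rewrite mxE; apply/floor_def; rewrite intrD.
by have /andP[h1 h2] := h i; apply/andP; split; lra.
Qed.

Lemma lround_sub (u : 'rV[R]_n) : Q_half (u - map_mx intr (lround u)).
Proof.
have /lroundP h := erefl (lround u); move=> i; have := h i; rewrite !mxE.
by move=> /andP[h1 h2]; rewrite ler_norml; apply/andP; split; lra.
Qed.

Lemma lround_subC (u : 'rV[R]_n) : Q_half (map_mx intr (lround u) - u).
Proof. by move=> i; have := lround_sub u i; rewrite -opprB mxE normrN. Qed.

Lemma volume_unit_box (I : 'I_n -> set (measurableTypeR R)) :
  (forall i, measurable (I i)) -> (forall i, lebesgue_measure (I i) = 1%E) ->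
  lebesgue_rV n [set u : 'rV[R]_n | forall i, I i (u ord0 i)] = 1%E.
Proof.
by move=> mI I1; rewrite lebesgue_rV_box// big1.
Qed.

Let cell (z : 'rV[int]_n) (i : 'I_n) : set (measurableTypeR R) :=
  `[(z ord0 i)%:~R - 2^-1, (z ord0 i)%:~R + 2^-1[%classic.

Let reflected_cell (x : 'rV[R]_n) (z : 'rV[int]_n) (i : 'I_n) :
    set (measurableTypeR R) :=
  `]x ord0 i - (z ord0 i)%:~R - 2^-1, x ord0 i - (z ord0 i)%:~R + 2^-1]%classic.

Lemma lround_cellE z :
  lround @^-1` [set z] = [set u | forall i, cell z i (u ord0 i)].
Proof.
by apply/seteqP; split => [u /lroundP h i|u h]; [|apply/lroundP => i];
  have := h i; rewrite /cell /= in_itv.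
Qed.

Lemma measurable_lround_cell z : measurable (lround @^-1` [set z]).
Proof.
rewrite lround_cellE; apply: (@measurable_box R n (cell z)) => i.
exact: measurable_itv.
Qed.

Lemma volume_lround_cell z : lebesgue_rV n (lround @^-1` [set z]) = 1%E.
Proof.
rewrite lround_cellE; apply: (@volume_unit_box (cell z)) => i.
  exact: measurable_itv.
rewrite lebesgue_measure_itv/= lte_fin -EFinB ifT; last lra.
by congr EFin; lra.
Qed.

(** The reflection w -> x - w exchanges the open and closed ends of the cells,
    hence the half-open intervals on the other side. *)
Lemma lround_subl_cellE (x : 'rV[R]_n) (z : 'rV[int]_n) :
  (fun w => lround (x - w)) @^-1` [set z] =
  [set w | forall i, reflected_cell x z i (w ord0 i)].
Proof.
by apply/seteqP; split => [u /lroundP h i|u h]; [|apply/lroundP => i];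
  have := h i; rewrite /reflected_cell /= in_itv/= !mxE => /andP[h1 h2];
  apply/andP; split; lra.
Qed.

Lemma measurable_lround_subl_cell (x : 'rV[R]_n) z :
  measurable ((fun w => lround (x - w)) @^-1` [set z]).
Proof.
rewrite lround_subl_cellE; apply: (@measurable_box R n (reflected_cell x z)).
by move=> i; exact: measurable_itv.
Qed.

Lemma volume_lround_subl_cell (x : 'rV[R]_n) z :
  lebesgue_rV n ((fun w => lround (x - w)) @^-1` [set z]) = 1%E.
Proof.
rewrite lround_subl_cellE; apply: (@volume_unit_box (reflected_cell x z)) => i.
  exact: measurable_itv.
rewrite lebesgue_measure_itv/= lte_fin -EFinB ifT; last lra.
by congr EFin; lra.
Qed.

Lemma ge0_integral_lround (h : 'rV[int]_n -> \bar R) : (forall z, 0 <= h z)%E ->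
  (\int[lebesgue_rV n]_u h (lround u) = \esum_(z in [set: 'rV[int]_n]) h z)%E.
Proof.
move=> h0; rewrite (ge0_integral_comp_countable _ measurable_lround_cell)//.
apply: eq_esum => z _; rewrite setTI.
by have := volume_lround_cell z => /= ->; rewrite mule1.
Qed.

End rounding.

(** * Borel measurability of closed sets *)

Section closed_measurable.
Variables (R : realType) (n : nat).

(** The sigma-algebra is generated by coordinates, so an open set is written as
    a countable union of boxes with rational centres and radii 1/(k+1). *)
Lemma open_measurable_rV (U : set 'rV[R]_n) : open U -> measurable U.
Proof.
move=> oU.
pose B (q : 'rV[rat]_n * nat) : set 'rV[R]_n :=
  [set u | forall i, `](ratr (q.1 ord0 i) : R) - q.2.+1%:R^-1,
     ratr (q.1 ord0 i) + q.2.+1%:R^-1[%classic (u ord0 i)].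
have mB q : measurable (B q).
  apply: (@measurable_box R n (fun i => `](ratr (q.1 ord0 i) : R) - q.2.+1%:R^-1,
     ratr (q.1 ord0 i) + q.2.+1%:R^-1[%classic)) => i; exact: measurable_itv.
rewrite (_ : U = \bigcup_(q in [set q | B q `<=` U]) B q).
  rewrite bigcup_mkcond; apply: countable_bigcupT_measurable => // q.
  by case: ifPn.
apply/seteqP; split => [u Uu|u [q /= qU Bq]]; last exact: qU.
have /nbhs_ballP[e /= e0 eU] := open_nbhs_nbhs (conj oU Uu).
(* A box of radius r < e/2 whose centre is within r of u stays inside the
   e-ball around u. *)
have e20 : 0 < e / 2 by rewrite divr_gt0.
have [k ke] : exists k : nat, (k.+1%:R^-1 : R) < e / 2.
  by have [N _ h] := near_infty_natSinv_lt (PosNum e20); exists N;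
    exact: (h N (leqnn N)).
have k0 : (0 : R) < k.+1%:R^-1 by rewrite invr_gt0.
have [r rE] : {r : R | k.+1%:R^-1 = r} by exists k.+1%:R^-1.
rewrite rE in ke k0.
have H i : {q : rat | `|u ord0 i - ratr q| < r}.
  apply: cid.
  have [|q] := @rat_in_itvoo R (u ord0 i - r) (u ord0 i + r); first by lra.
  rewrite in_itv/= => /andP[h1 h2]; exists q.
  by rewrite ltr_norml; apply/andP; split; lra.
exists (\row_i sval (H i), k) => /=.
  move=> v Bv; apply: eU; split => // i j; rewrite ord1.
  have := Bv j; rewrite /= in_itv/= rE mxE; case: (H j) => q /= hq /andP[h1 h2].
  move: hq; rewrite ltr_norml => /andP[h3 h4].
  by rewrite /ball /= ltr_norml; apply/andP; split; lra.
move=> i; rewrite /= in_itv/= rE mxE; case: (H i) => q /=.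
by rewrite ltr_norml => /andP[h3 h4]; apply/andP; split; lra.
Qed.

Lemma closed_measurable_rV (C : set 'rV[R]_n) : closed C -> measurable C.
Proof.
move=> cC; rewrite -[C]setCK; apply: measurableC; apply: open_measurable_rV.
exact: closed_openC.
Qed.

End closed_measurable.

(** * Symmetric convex bodies *)

Section body.
Variables (R : realType) (n : nat) (G : set 'rV[R]_n).
Hypothesis bodyG : symmetric_convex_body G.

Lemma body_conv (a b : R) x y : 0 <= a -> 0 <= b -> a + b = 1 ->
  G x -> G y -> G (a *: x + b *: y).
Proof.
move=> a0 b0 ab Gx Gy.
have a1 : a <= 1 by lra.
have -> : b = 1 - a by lra.
have := scb_convex bodyG (Itv01 a0 a1) (mem_set Gx) (mem_set Gy).
by move/set_mem.
Qed.

Lemma body_opp x : G x -> G (- x).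
Proof. by move=> Gx; rewrite -(scb_symmetric bodyG); exists x. Qed.

(** a x is the convex combination of x and -x with weights (1+a)/2 and
    (1-a)/2. *)
Lemma body_shrink (a : R) x : `|a| <= 1 -> G x -> G (a *: x).
Proof.
rewrite ler_norml => /andP[a1 a2] Gx.
rewrite (_ : a *: x = ((1 + a) / 2) *: x + ((1 - a) / 2) *: (- x)).
  by apply: body_conv => //; [lra|lra|lra|exact: body_opp].
by rewrite scalerN -scalerBl; congr (_ *: _); lra.
Qed.

Lemma dilateP (t : R) : 0 < t -> [set t *: y | y in G] = dilate t G.
Proof.
move=> t0; apply/seteqP; split => [_ [y Gy <-]|y Gy].
  by rewrite /dilate /= scalerA mulVf ?gt_eqF// scale1r.
by exists (t^-1 *: y) => //; rewrite scalerA divff ?gt_eqF// scale1r.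
Qed.

(** (x+y)/(s+t) is the convex combination of x/s and y/t with weights s/(s+t)
    and t/(s+t). *)
Lemma dilateD (s t : R) x y : 0 < s -> 0 < t ->
  dilate s G x -> dilate t G y -> dilate (s + t) G (x + y).
Proof.
rewrite /dilate /= => s0 t0 Gx Gy.
have st0 : 0 < s + t by lra.
rewrite (_ : _ *: _ =
    (s / (s + t)) *: (s^-1 *: x) + (t / (s + t)) *: (t^-1 *: y)).
  apply: body_conv => //; rewrite ?divr_ge0 ?ltW//.
  by rewrite -mulrDl divff ?gt_eqF.
by rewrite !scalerA scalerDr; congr (_ *: _ + _ *: _); field;
  rewrite ?gt_eqF.
Qed.

(** Averaging a ball around an interior point x with the point -x of G gives a
    ball around the origin. *)
Lemma body_ball0 : exists2 e : R, 0 < e &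
  forall v : 'rV[R]_n, (forall i, `|v ord0 i| <= e) -> G v.
Proof.
have [x /nbhs_ballP[e /= e0 eG]] := scb_interior bodyG.
(* v is the midpoint of x + 2v and -x, and 2v has size at most e/2 < e. *)
exists (e / 4); first lra.
move=> v hv.
have Gx : G x by apply: eG; exact: ballxx.
rewrite (_ : v = 2^-1 *: (x + 2 *: v) + 2^-1 *: (- x)).
  apply: body_conv; [lra|lra|lra| |exact: body_opp].
  apply: eG; split => // i j; rewrite ord1 !mxE /ball /=.
  rewrite opprD addrA subrr sub0r normrN normrM.
  by have := hv j; rewrite ger0_norm//; lra.
by rewrite scalerDr scalerA scalerN addrAC subrr add0r mulVf// scale1r.
Qed.

Lemma body_bounded : exists2 M : R, 0 < M &
  forall x, G x -> forall i, `|x ord0 i| <= M.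
Proof.
have [M [_ h']] := scb_bounded bodyG.
have M1 : M < `|M| + 1 by rewrite (le_lt_trans (ler_norm M)) ?ltrDl.
have h := h' (`|M| + 1) M1.
exists (`|M| + 1) => [|x Gx i]; first by rewrite ltr_wpDl.
have := h x Gx; apply: le_trans.
rewrite [leRHS]mx_normrE.
by rewrite (@le_bigmax _ _ _ 0 (fun ij : 'I_1 * 'I_n => `|x ij.1 ij.2|) (ord0, i)).
Qed.

Lemma measurable_dilate (t : R) : 0 < t -> measurable (dilate t G).
Proof.
by move=> t0; apply: measurable_dilate_rV => //;
  apply: closed_measurable_rV; exact: scb_closed bodyG.
Qed.

Lemma dilate_box (t : R) : 0 < t ->
  exists2 B : R, 0 < B & forall y, dilate t G y -> forall i, `|y ord0 i| <= B.
Proof.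
move=> t0; have [M M0 hM] := body_bounded; exists (t * M); first exact: mulr_gt0.
move=> y Gy i; have := hM _ Gy i.
by rewrite mxE normrM gtr0_norm ?invr_gt0// ler_pdivrMl.
Qed.

Lemma finite_lattice_dilate (t : R) : 0 < t -> finite_set (lattice_dilate t G).
Proof.
move=> t0; have [B B0 hB] := dilate_box t0.
pose K := Num.bound B.
pose e (z : 'rV['I_(2 * K).+1]_n) : 'rV[int]_n := \row_i ((z ord0 i)%:Z - K%:Z).
apply: (@sub_finite_set _ _ (range e)); last first.
  by apply: finite_image; exact: finite_finset.
move=> z /hB hz.
have zK i : `|z ord0 i| <= K%:Z.
  rewrite -(ler_int R) intr_norm; have := hz i; rewrite mxE => /le_trans; apply.
  by rewrite ltW//; apply: archi_boundP; exact: ltW.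
exists (\row_i inord (absz (z ord0 i + K%:Z)%R)) => //.
apply/rowP => i; rewrite !mxE; have := zK i; rewrite ler_norml => /andP[h1 h2].
have -> : z 0 i = z ord0 i by congr (z _ _); exact/val_inj.
by rewrite inordK; lia.
Qed.

Let N (t : R) := #|` fset_set (lattice_dilate t G)|.

Lemma sumr_lattice1 (t : R) : 0 < t ->
  (\sum_(z \in lattice_dilate t G) (1%:E : \bar R))%E = (N t)%:R%:E.
Proof.
move=> t0; rewrite fsbig_finite//=; last exact: finite_lattice_dilate.
by rewrite sumEFin big_const_seq count_predT iter_addr_0.
Qed.

(** The origin is always counted. *)
Lemma lattice_count_ge1 (t : R) : 0 < t -> (1 <= N t)%N.
Proof.
move=> t0; rewrite /N cardfs_gt0; apply/fset0Pn; exists 0.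
rewrite in_fset_set; last exact: finite_lattice_dilate.
apply/mem_set; rewrite /lattice_dilate /dilate /= map_mx0 scaler0.
have [e e0 eG] := body_ball0; apply: eG => i.
by rewrite mxE normr0 ltW.
Qed.

Let cset : set R := [set t | 0 < t /\ @Q_half R n `<=` dilate t G].

Lemma c_bodyE : c_body G = inf cset.
Proof.
congr inf; apply/seteqP.
by split => t [t0]; rewrite ?dilateP// => h; split => //; rewrite ?dilateP.
Qed.

(** A small enough copy of the unit cube fits in a ball around the origin
    contained in G; were no dilate of G to contain the cube, the infimum c(G)
    would be that of the empty set. *)
Lemma cset_neq0 : cset !=set0.
Proof.
have [e e0 eG] := body_ball0; exists (2 * e)^-1; split.
  by rewrite invr_gt0 mulr_gt0.
move=> u Qu; apply: eG => i; rewrite mxE invrK normrM gtr0_norm; last lra.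
have := Qu i; rewrite -(@ler_pM2l _ (2 * e)); last lra.
by move=> /le_trans; apply; lra.
Qed.

Hypothesis n_gt0 : (0 < n)%N.

(** If tG contains the cube, it contains the corner (1/2, ..., 1/2), while the
    coordinates of points of tG are at most tM; this needs a coordinate,
    i.e. positive dimension. *)
Lemma cset_lbound : exists2 m : R, 0 < m & lbound cset m.
Proof.
have [M M0 hM] := body_bounded; exists (2 * M)^-1.
  by rewrite invr_gt0 mulr_gt0.
move=> t [t0 Qt].
have Qh : Q_half (const_mx 2^-1 : 'rV[R]_n).
  by move=> i; rewrite mxE ger0_norm// invr_ge0.
have := hM _ (Qt _ Qh) (Ordinal n_gt0).
rewrite !mxE ger0_norm ?mulr_ge0 ?invr_ge0// ?(ltW t0)// ler_pdivrMl// => h.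
by rewrite -[leLHS]mul1r ler_pdivrMr ?mulr_gt0//; lra.
Qed.

Lemma c_body_gt0 : 0 < c_body G.
Proof.
have [m m0 hm] := cset_lbound; apply: (lt_le_trans m0).
by rewrite c_bodyE; apply: lb_le_inf => //; exact: cset_neq0.
Qed.

(** The infimum is attained: for u in the cube, u/t belongs to G for t
    arbitrarily close to c from above, and G is closed. *)
Lemma Q_half_sub_dilate_c : @Q_half R n `<=` dilate (c_body G) G.
Proof.
have c0 := c_body_gt0; set c := c_body G in c0 *.
move=> u Qu; apply: contrapT => nG.
have /nbhs_ballP[e /= e0 eG] :=
  open_nbhs_nbhs (conj (closed_openC (scb_closed bodyG)) nG).
have hinf : has_inf cset.
  by split; [exact: cset_neq0|have [m _ hm] := cset_lbound; exists m].
have d0 : 0 < e * c ^+ 2 by rewrite mulr_gt0// exprn_gt0.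
have [t [t0 Qt] tc] := inf_adherent d0 hinf.
rewrite -c_bodyE -/c in tc.
have ct : c <= t.
  by rewrite /c c_bodyE; apply: ge_inf => //; exact: (hinf.2).
apply: (eG (t^-1 *: u)); last exact: Qt.
split => // i j; rewrite ord1 !mxE /ball/= -mulrBl normrM.
(* t - c < e c^2 was chosen so that 1/c - 1/t = (t - c)/(ct) < e. *)
have h1 : `|c^-1 - t^-1| < e.
  rewrite ger0_norm; last by rewrite subr_ge0 lef_pV2 ?posrE.
  rewrite (_ : _ - _ = (t - c) / (c * t)); last by field; rewrite ?gt_eqF.
  rewrite ltr_pdivrMr ?mulr_gt0//.
  apply: (@lt_le_trans _ _ (e * c ^+ 2)); first lra.
  by rewrite ler_pM2l// expr2 ler_pM2l.
apply: le_lt_trans h1; rewrite -[leRHS]mulr1 ler_wpM2l//.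
by have := Qu j; lra.
Qed.

(** Positivity and finiteness of the volume of cG: it contains a unit cell and
    is contained in a box. *)
Lemma volume_dilate_c : exists2 V : R, 1 <= V &
  lebesgue_rV n (dilate (c_body G) G) = V%:E.
Proof.
have c0 := c_body_gt0.
have [B B0 hB] := dilate_box c0.
have mD := measurable_dilate c0.
have m1 (i : 'I_n) :
    measurable (`[- B, B]%classic : set (measurableTypeR R)).
  by exact: measurable_itv.
have mbox := measurable_box m1.
have le1 : (1 <= lebesgue_rV n (dilate (c_body G) G))%E.
  rewrite -(@volume_lround_cell R n 0).
  apply: le_measure; rewrite ?inE//; first exact: measurable_lround_cell.
  move=> u /= u0; apply: Q_half_sub_dilate_c.
  by have := lround_sub u; rewrite u0 map_mx0 subr0.
have lty : (lebesgue_rV n (dilate (c_body G) G) < +oo)%E.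
  apply: (@le_lt_trans _ _
    (lebesgue_rV n [set u | forall i, `[- B, B]%classic (u ord0 i)])).
    apply: le_measure; rewrite ?inE//.
    by move=> u Gu i; rewrite /= in_itv/= -ler_norml; exact: hB.
  rewrite (lebesgue_rV_box m1) ltey_eq; apply/orP; left.
  apply: (big_ind (fun x : \bar R => x \is a fin_num)) => //.
    by move=> x y; exact: fin_numM.
  by move=> i _; rewrite lebesgue_measure_itv/=; case: ifP.
move: le1 lty; case: (lebesgue_rV n _) => // V; rewrite lee_fin => V1 _.
by exists V.
Qed.

Lemma volume_dilateE : exists2 V : R, 1 <= V & forall t, 0 < t ->
  lebesgue_rV n (dilate t G) = ((t / c_body G) ^+ n * V)%:E.
Proof.
have [V V1 hV] := volume_dilate_c; exists V => // t t0.
have c0 := c_body_gt0.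
rewrite (_ : dilate t G = dilate (t / c_body G) (dilate (c_body G) G)).
  rewrite lebesgue_rV_dilate ?divr_gt0//; last exact: measurable_dilate.
  by rewrite hV EFinM.
apply/seteqP; split => y; rewrite /dilate /= scalerA invfM invrK;
 by rewrite [_ * c_body G]mulrC mulrA mulVf ?gt_eqF// mul1r.
Qed.


(** A point u of cG outside [-1/2, 1/2] would make c/(2|u|) < c an admissible
    dilation factor, contradicting the minimality of c. *)
Lemma dilate_c_dim1 : n = 1%N -> dilate (c_body G) G `<=` @Q_half R n.
Proof.
have c0 := c_body_gt0; move=> n1 u Gu i.
rewrite leNgt; apply/negP => ui.
have ci : (c_body G) <= c_body G / (2 * `|u ord0 i|).
  rewrite [leLHS]c_bodyE; apply: ge_inf.
    by have [m _ hm] := cset_lbound; exists m.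
  split; first by rewrite divr_gt0//; lra.
  move=> v Qv; rewrite /dilate /= invfM invrK.
  have i0 : u ord0 i != 0 by rewrite -normr_gt0; lra.
  rewrite (_ : _ *: v = (2 * `|u ord0 i| * (u ord0 i)^-1 * v ord0 i) *:
                        ((c_body G)^-1 *: u)).
    apply: body_shrink => //.
    rewrite !normrM normfV normr_id mulfK ?normr_eq0// ger0_norm//.
    by have := Qv i; lra.
  apply/rowP => j; have -> : j = i.
    by clear -n1; move: i j; rewrite n1 => i j; rewrite !ord1.
  by rewrite !mxE; field; rewrite gt_eqF.
move: ci; rewrite ler_pdivlMr; last lra.
rewrite -[leRHS]mulr1 ler_pM2l//; lra.
Qed.

Lemma volume_dilate_c_dim1 : n = 1%N ->
  (lebesgue_rV n (dilate (c_body G) G) <= 1)%E.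
Proof.
move=> n1.
have m1 (i : 'I_n) :
    measurable (`[- 2^-1, 2^-1]%classic : set (measurableTypeR R)).
  by exact: measurable_itv.
rewrite -(volume_unit_box m1); last first.
  move=> i; rewrite lebesgue_measure_itv/= lte_fin -EFinB ifT; last lra.
  by congr EFin; lra.
apply: le_measure; rewrite ?inE//.
- by apply: measurable_dilate; exact: c_body_gt0.
- exact: (measurable_box m1).
- move=> u Gu i; rewrite /= in_itv/= -ler_norml; exact: dilate_c_dim1.
Qed.

(** Rounding a point of G_(t-c) adds a vector of the cube, which lies in G_c;
    so only cells of lattice points of G_t meet G_(t-c). *)
Lemma volume_le_lattice_count (t : R) : c_body G < t ->
  (lebesgue_rV n (dilate (t - c_body G) G) <= (N t)%:R%:E)%E.
Proof.
have c0 := c_body_gt0; move=> ct; have t0 : 0 < t by lra.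
set D := dilate _ _.
have mD : measurable D by apply: measurable_dilate; lra.
rewrite -sumr_lattice1// -esum_fset; last 2 first.
- exact: finite_lattice_dilate.
- by [].
rewrite -[leLHS]mul1e -integral_cst//.
rewrite (ge0_integral_comp_countable (lebesgue_rV n) (@measurable_lround_cell R n)
  (h := fun=> 1%E))//.
rewrite [leRHS]esum_mkcond; apply: le_esum => z _; rewrite mul1e.
case: ifPn => [_|/negP zL].
  rewrite -(@volume_lround_cell R n z); apply: le_measure; rewrite ?inE//.
  - by apply: measurableI => //; exact: measurable_lround_cell.
  - exact: measurable_lround_cell.
rewrite (_ : _ `&` _ = set0) ?measure0// -subset0 => u [Du /= uz].
apply: zL; apply/mem_set; rewrite /lattice_dilate /= -uz.
rewrite (_ : map_mx _ _ = u + (map_mx intr (lround u) - u)); 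
  last by rewrite addrCA subrr addr0.
rewrite (_ : t = t - c_body G + c_body G); last by rewrite subrK.
apply: dilateD => //; first lra.
exact: Q_half_sub_dilate_c (lround_subC u).
Qed.

(** The points w with lround (u - w) = lround u - y form a unit cell contained
    in G_(t+2c): w - y is the sum of the rounding errors of u - w and of u,
    each of which lies in the cube. *)
Lemma lattice_sum_le_integral (g : 'rV[int]_n -> R) (t : R) (u : 'rV[R]_n) :
  0 < t -> (forall z, 0 <= g z) ->
  (\sum_(y \in lattice_dilate t G) (g (lround u - y))%:E <=
   \int[lebesgue_rV n]_(w in dilate (t + 2 * c_body G) G)
     (g (lround (u - w)))%:E)%E.
Proof.
have c0 := c_body_gt0; move=> t0 g0.
set D := dilate _ _; set x := lround u.
have mD : measurable D by apply: measurable_dilate; lra.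
(* phi w is the lattice shift y seen at w, so the integrand is g (x - phi w). *)
pose phi (w : 'rV[R]_n) := x - lround (u - w).
have phiE y : phi @^-1` [set y] = (fun w => lround (u - w)) @^-1` [set (x - y)].
  apply/seteqP; rewrite /phi; split => w /= => [<-|->];
    first by rewrite opprB addrCA subrr addr0.
  by rewrite opprB addrCA subrr addr0.
have mphi y : measurable (phi @^-1` [set y]).
  by rewrite phiE; exact: measurable_lround_subl_cell.
rewrite (eq_integral (fun w => (g (x - phi w))%:E)); last first.
  by move=> w _; rewrite /phi opprB addrCA subrr addr0.
rewrite (ge0_integral_comp_countable (lebesgue_rV n) mphi (h := fun y => (g (x - y))%:E))//;
  last first.
  by move=> y; rewrite lee_fin.
apply: ereal_sup_ge; exists (\sum_(y \in lattice_dilate t G)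
  ((g (x - y))%:E * lebesgue_rV n (D `&` phi @^-1` [set y]))%E)%E.
  by exists (lattice_dilate t G) => //; split => //; exact: finite_lattice_dilate.
apply: lee_fsum; first exact: finite_lattice_dilate.
move=> y Ly; rewrite (_ : D `&` _ = phi @^-1` [set y]).
  by rewrite phiE volume_lround_subl_cell mule1.
apply/setIidr; rewrite phiE => w /= E.
(* w = y + (rounding error of u - w) + (rounding error of u). *)
rewrite (_ : w = map_mx intr y + ((map_mx intr (lround (u - w)) - (u - w))
  + (u - map_mx intr x))).
  apply: dilateD => //; first lra.
  rewrite mulr_natl mulr2n; apply: dilateD => //; apply: Q_half_sub_dilate_c.
    exact: lround_subC.
  exact: lround_sub.
rewrite E map_mxB; apply/rowP => i; rewrite !mxE; lra.
Qed.

(** With s = t/c, the volume is (s+2)^n V and N >= (s-1)^n V, where V is the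
    volume of cG. For n >= 2 one has (s+2)/(s-1) = 1 + 3/(s-1) <= exp(3/(n-1))
    and 3n/(n-1) <= 6; for n = 1 the bound V <= 1 takes over near s = 1. *)
Lemma volume_dilate_le_lattice_count (t : R) : c_body G * n%:R <= t ->
  (lebesgue_rV n (dilate (t + 2 * c_body G) G) <= (expR 6 * (N t)%:R)%:E)%E.
Proof.
have c0 := c_body_gt0; move=> tn.
have [V V1 hV] := volume_dilateE.
have n1 : 1 <= n%:R :> R by rewrite ler1n.
have tc : c_body G <= t by apply: le_trans tn; rewrite ler_peMr// ltW.
have t0 : 0 < t by lra.
rewrite hV ?lee_fin; last lra.
set c := c_body G in c0 tn hV tc *.
have -> : (t + 2 * c) / c = t / c + 2 by field; rewrite gt_eqF.
have NV : c < t -> (t / c - 1) ^+ n * V <= (N t)%:R.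
  move=> ct; have := volume_le_lattice_count ct; rewrite hV ?lee_fin; last lra.
  by have -> : (t - c) / c = t / c - 1 by field; rewrite gt_eqF.
have : n%:R <= t / c by rewrite ler_pdivlMr// mulrC.
set s := t / c in NV * => sn.
have [n_eq1|n_neq1] := eqVneq n 1.
  have VV : V <= 1.
    have := volume_dilate_c_dim1 n_eq1.
    by rewrite hV// divff ?gt_eqF// expr1n mul1r lee_fin.
  have e7 : 7 <= expR 6 :> R by have := expR_ge1Dx (6 : R); lra.
  have N1 : 1 <= (N t)%:R :> R by rewrite ler1n lattice_count_ge1.
  have s1 : 1 <= s by lra.
  have [s2|s2] := leP s 2.
    rewrite n_eq1 expr1; nra.
  have ct : c < t by move: s2; rewrite ltr_pdivlMr//; lra.
  by have := NV ct; rewrite n_eq1 !expr1; nra.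
have n2 : 2 <= n%:R :> R by rewrite ler_nat; move: (n_gt0) (n_neq1); clear; lia.
have ct : c < t by rewrite -[c]mul1r -ltr_pdivlMr// -/s; lra.
apply: (@le_trans _ _ (expR 6 * ((s - 1) ^+ n * V))); last first.
  by rewrite ler_wpM2l ?expR_ge0// NV.
rewrite mulrA ler_wpM2r//; first lra.
have s10 : 0 < s - 1 by lra.
rewrite -ler_pdivrMr ?exprn_gt0// -expr_div_n.
have -> : (s + 2) / (s - 1) = 1 + 3 / (s - 1) by field; rewrite gt_eqF.
apply: (@le_trans _ _ (expR (3 / (s - 1)) ^+ n)).
  rewrite lerXn2r ?nnegrE ?expR_ge0 ?addr_ge0 ?divr_ge0//; [lra|exact: expR_ge1Dx].
rewrite -expRM_natl ler_expR mulrA ler_pdivrMr//; lra.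
Qed.

End body.

(** * Norms *)

Section norms.
Variables (R : realType) (n : nat).

(** The integral of a nonnegative function is the supremum of the integrals of
    the simple functions below it, hence monotone on all functions,
    measurable or not; it is applied to the supremum of uncountably many
    averages. *)
Lemma ge0_le_integral_fun d (T : measurableType d)
    (mu : {measure set T -> \bar R}) (D : set T) (f g : T -> \bar R) :
  (forall x, D x -> 0 <= f x)%E -> (forall x, D x -> f x <= g x)%E ->
  (\int[mu]_(x in D) f x <= \int[mu]_(x in D) g x)%E.
Proof.
move=> f0 fg; rewrite !ge0_integralE//; last first.
  by move=> x Dx; rewrite (le_trans (f0 x Dx)) ?fg.
apply: ereal_sup_le => _ [h hf <-]; exists h => // x.
apply: (le_trans (hf x)); rewrite /patch; case: ifPn => // /set_mem; exact: fg.
Qed.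

Lemma ge0_le_Lnorm d (T : measurableType d) (mu : {measure set T -> \bar R})
    (p : R) (f g : T -> \bar R) : 0 < p ->
  (forall x, 0 <= f x)%E -> (forall x, f x <= g x)%E ->
  ('N[mu]_(p%:E)[f] <= 'N[mu]_(p%:E)[g])%E.
Proof.
move=> p0 f0 fg; rewrite unlock /Lnorm.
have g0 x : (0 <= g x)%E by apply: le_trans (fg x).
apply: gt0_ler_poweR; first by rewrite invr_ge0 ltW.
- by rewrite in_itv/= leey andbT; apply: integral_ge0 => x _; exact: poweR_ge0.
- by rewrite in_itv/= leey andbT; apply: integral_ge0 => x _; exact: poweR_ge0.
apply: ge0_le_integral_fun => x _; first exact: poweR_ge0.
rewrite !gee0_abs//; apply: gt0_ler_poweR => //; first exact: ltW.
  by rewrite in_itv/= f0 leey.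
by rewrite in_itv/= g0 leey.
Qed.

Lemma Lnorm_comp_lround (p : R) (h : 'rV[int]_n -> \bar R) :
  'N[lebesgue_rV n]_(p%:E)[h \o @lround R n]%E = ell_norm p h.
Proof.
rewrite unlock /Lnorm /ell_norm; congr (_ `^ _)%E.
rewrite -(@ge0_integral_lround R n (fun z => `|h z| `^ p)%E)//.
by move=> z; exact: poweR_ge0.
Qed.

(** The scalar is taken out of the sum by passing to the integral of the step
    function. *)
Lemma ell_normZ (p k : R) (h : 'rV[int]_n -> \bar R) : 0 < p -> 0 <= k ->
  ell_norm p (fun z => k%:E * h z)%E = (k%:E * ell_norm p h)%E.
Proof.
move=> p0 k0; rewrite /ell_norm.
pose H z := (`|h z| `^ p)%E.
have H0 z : (0 <= H z)%E by exact: poweR_ge0.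
transitivity ((\esum_(z in [set: 'rV[int]_n]) ((k `^ p)%:E * H z)) `^ p^-1)%E.
  congr (_ `^ _)%E; apply: eq_esum => z _.
  by rewrite abseM poweRM// gee0_abs ?lee_fin.
rewrite -(@ge0_integral_lround R n); last first.
  by move=> z; rewrite mule_ge0 ?lee_fin ?powR_ge0.
rewrite ge0_integralZl ?lee_fin ?powR_ge0//; last first.
  exact: (measurable_comp_countable (@measurable_lround_cell R n)).
rewrite ge0_integral_lround// poweRM ?esum_ge0 ?lee_fin ?powR_ge0//.
by rewrite poweR_EFin -powRrM mulfV ?gt_eqF// powRr1.
Qed.

Lemma le_ell_norm (p : R) (h : 'rV[int]_n -> \bar R) z : 0 < p ->
  (`|h z| <= ell_norm p h)%E.
Proof.
move=> p0; rewrite /ell_norm -[leLHS](@poweRe1 R)//.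
rewrite -(@mulfV _ p) ?gt_eqF// poweRrM.
have e0 : (0 <= \esum_(x in [set: 'rV[int]_n]) `|h x| `^ p)%E.
  by apply: esum_ge0 => x _; exact: poweR_ge0.
apply: gt0_ler_poweR; rewrite ?in_itv/= ?leey ?andbT ?poweR_ge0//.
  by rewrite invr_ge0 ltW.
rewrite -(@esum_set1 _ _ z (fun x => `|h x| `^ p)%E) ?poweR_ge0//.
rewrite esum_mkcond; apply: le_esum => x _; case: ifPn => // _.
exact: poweR_ge0.
Qed.

Local Open Scope complex_scope.

Lemma normc_real (x : R) : Normc.normc x%:C = `|x|.
Proof. by rewrite /Normc.normc /= expr0n addr0 sqrtr_sqr. Qed.

Lemma normc_sum (I : Type) (s : seq I) (F : I -> R[i]) :
  Normc.normc (\sum_(i <- s) F i) <= \sum_(i <- s) Normc.normc (F i).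
Proof.
elim/big_ind2: _ => [|x a y b ax bY|//]; first by rewrite Normc.normc0.
by apply: le_trans (le_normcD _ _) _; exact: lerD.
Qed.

Lemma normc_ge0 (z : R[i]) : 0 <= Normc.normc z.
Proof. by case: z => a b; exact: sqrtr_ge0. Qed.

End norms.

(** * Comparison of discrete and continuous averages *)

Section comparison.
Variables (R : realType) (n : nat) (G : set 'rV[R]_n).
Hypothesis bodyG : symmetric_convex_body G.
Hypothesis n_gt0 : (0 < n)%N.
Local Open Scope complex_scope.

(** K separates the size of f from that of its normalised majorant g. The bound
    B makes the integral of the step function finite, so that its real-valued
    version is the extended one. *)
Lemma discrete_avg_le_continuous (f : 'rV[int]_n -> R[i]) (g : 'rV[int]_n -> R)
    (K B t : R) (u : 'rV[R]_n) :
  0 <= K -> (forall z, Normc.normc (f z) <= K * g z) ->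
  (forall z, 0 <= g z <= B) -> c_body G * n%:R <= t ->
  (cabs (discrete_avg G t f) (lround u) <=
   (expR 6 * K)%:E * cabs (continuous_avg G (t + 2 * c_body G)
                         (fun v => (g (lround v))%:C)) u)%E.
Proof.
move=> K0 fg gB tn.
have g0 z : 0 <= g z by case/andP: (gB z).
have c0 := c_body_gt0 bodyG n_gt0.
have n1 : 1 <= n%:R :> R by rewrite ler1n.
have t0 : 0 < t by apply: lt_le_trans tn; rewrite mulr_gt0//; lra.
have s0 : 0 < t + 2 * c_body G by lra.
have finL := finite_lattice_dilate bodyG t0.
have N1 := lattice_count_ge1 bodyG t0.
have [V V1 hV] := volume_dilateE bodyG n_gt0.
have vN := volume_dilate_le_lattice_count bodyG n_gt0 tn.
have SI := lattice_sum_le_integral bodyG n_gt0 u t0 g0.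
set D := dilate (t + _) G in vN SI *.
have {}hV := hV _ s0; rewrite -/D in hV.
set v := (_ / _) ^+ n * V in hV.
have v0 : 0 < v by rewrite mulr_gt0 ?exprn_gt0 ?divr_gt0//; lra.
rewrite hV lee_fin in vN.
rewrite fsbig_finite//= sumEFin in SI.
set S := (\sum_(i <- _) _)%R in SI.
set I := (\int[_]_(w in D) _)%E in SI.
have IB : (I <= (B * v)%:E)%E.
  rewrite EFinM -hV -integral_cst; last exact: measurable_dilate.
  by apply: ge0_le_integral_fun => x _; rewrite lee_fin//;
    case/andP: (gB (lround (u - x))).
have [J IJ] : exists J, I = J%:E.
  by move: SI IB; case: (I) => // J _ _; exists J.
rewrite IJ lee_fin in SI.
have S0 : 0 <= S by apply: sumr_ge0.
have -> : cabs (continuous_avg G (t + 2 * c_body G) (fun v => (g (lround v))%:C)) u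
    = (v^-1 * J)%:E.
  have CI : complex_integral D (fun y => (g (lround (u - y)))%:C) = J%:C.
    rewrite /complex_integral /Rintegral /= -/I IJ /=; congr Complex.
    by rewrite integral0.
  rewrite /cabs /continuous_avg -/D hV CI Normc.normcM !normc_real.
  by rewrite !ger0_norm// ?invr_ge0 ?(ltW v0)// (le_trans S0).
rewrite /cabs /discrete_avg -EFinM lee_fin Normc.normcM Normc.normcV.
set N := #|` _| in N1 vN *.
have -> : (N%:R : R[i]) = (N%:R)%:C by rewrite rmorph_nat.
rewrite normc_real ger0_norm ?ler0n//.
have N0 : 0 < N%:R :> R by rewrite ltr0n.
rewrite ler_pdivrMl// fsbig_finite//=.
apply: (le_trans (normc_sum _ _)).
apply: (@le_trans _ _ (K * S)).
  by rewrite mulr_sumr; apply: ler_sum => y _; exact: fg.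
(* What remains is S <= (e^6 N / v) J, which is S <= J combined with
   v <= e^6 N for the volume v of G_(t+2c). *)
have -> : N%:R * (expR 6 * K * (v^-1 * J)) = K * (expR 6 * N%:R / v * J) by ring.
rewrite ler_wpM2l//; apply: (le_trans SI).
rewrite -[leLHS]mul1r ler_wpM2r//; first lra.
by rewrite ler_pdivlMr// mul1r.
Qed.

Lemma discrete_maximal_le_continuous (f : 'rV[int]_n -> R[i])
    (g : 'rV[int]_n -> R) (K B : R) (u : 'rV[R]_n) :
  0 <= K -> (forall z, Normc.normc (f z) <= K * g z) ->
  (forall z, 0 <= g z <= B) ->
  (discrete_maximal_from G (c_body G * n%:R) f (lround u) <=
   (expR 6 * K)%:E * continuous_maximal G (fun v => (g (lround v))%:C) u)%E.
Proof.
move=> K0 fg gB; apply: ge_ereal_sup => _ [t /= tn <-].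
apply: (le_trans (discrete_avg_le_continuous u K0 fg gB tn)).
apply: lee_wpmul2l; first by rewrite lee_fin mulr_ge0 ?expR_ge0.
apply: ereal_sup_ubound; exists (t + 2 * c_body G) => //=.
have c0 := c_body_gt0 bodyG n_gt0.
have : c_body G * n%:R >= 0 by rewrite mulr_ge0// ltW.
lra.
Qed.

Lemma discrete_maximal_ge0 t0 (f : 'rV[int]_n -> R[i]) x :
  (0 <= discrete_maximal_from G t0 f x)%E.
Proof.
apply: (@le_trans _ _ (cabs (discrete_avg G t0 f) x)).
  by rewrite lee_fin normc_ge0.
by apply: ereal_sup_ubound; exists t0 => /=.
Qed.

End comparison.

Theorem theorem1 (R : realType) (d : nat) (d_gt0 : (0 < d)%N)
    (G : set 'rV[R]_d) (bodyG : symmetric_convex_body G)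
    (p : R) (p_gt1 : 1 < p) (f : 'rV[int]_d -> R[i])
    (f_ellp : (ell_norm p (cabs f) < +oo)%E) :
  (ell_norm p (discrete_maximal_from G (c_body G * d%:R) f)
   <= (expR 6)%:E * maximal_opnorm G p
      * ell_norm p (cabs f))%E.
Proof.
have p0 : 0 < p by lra.
have A0 : (0 <= ell_norm p (cabs f))%E by exact: poweR_ge0.
have [a fa] : exists a, ell_norm p (cabs f) = a%:E.
  by move: A0 f_ellp; case: (ell_norm _ _) => // a _ _; exists a.
rewrite fa in A0 f_ellp *; rewrite lee_fin in A0.
have fle z : Normc.normc (f z) <= a.
  have := le_ell_norm (cabs f) z p0.
  by rewrite fa /cabs /= lee_fin ger0_norm ?normc_ge0.
set D := discrete_maximal_from _ _ _.
have D0 z : (0 <= D z)%E by exact: discrete_maximal_ge0.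
(* Normalisation divides by the norm a, so f = 0 is treated apart: the
   pointwise comparison with K = 0 makes the maximal function vanish. *)
have [a_eq0|a_neq0] := eqVneq a 0.
  rewrite a_eq0 mule0 /ell_norm esum1 ?poweR0r ?invr_neq0 ?gt_eqF// => z _.
  suff -> : D z = 0%E by rewrite abse0 poweR0r ?gt_eqF.
  apply/eqP; rewrite eq_le D0 andbT.
  have -> : z = lround (map_mx intr z : 'rV[R]_d).
    apply/esym/lroundP => i; rewrite mxE; apply/andP; split; lra.
  have := @discrete_maximal_le_continuous _ _ _ bodyG d_gt0 f (fun=> 0) 0 0
    (map_mx intr z) (lexx 0).
  rewrite (mulr0 (expR 6)) mul0e; apply => // w; last by rewrite lexx.
  by rewrite mul0r -a_eq0.
have a0 : 0 < a by rewrite lt_neqAle eq_sym a_neq0.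
pose g z := a^-1 * Normc.normc (f z).
pose F (v : 'rV[R]_d) : R[i] := ((g (lround v))%:C)%C.
have cF : cabs F = (fun z => a^-1%:E * cabs f z)%E \o @lround R d.
  apply/funext => v; rewrite /cabs /F normc_real ger0_norm ?EFinM//.
  by rewrite mulr_ge0 ?normc_ge0 ?invr_ge0.
have F1 : ('N[lebesgue_rV d]_(p%:E)[cabs F] <= 1)%E.
  rewrite cF Lnorm_comp_lround ell_normZ ?invr_ge0// fa -EFinM mulVf//.
have mF : complex_measurable F.
  split.
    exact: (measurable_comp_countable (@measurable_lround_cell R d) g).
  exact: measurable_cst.
have K0 : 0 < expR 6 * a by rewrite mulr_gt0 ?expR_gt0.
have DF u : (((expR 6 * a)^-1)%:E * D (lround u) <= continuous_maximal G F u)%E.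
  rewrite lee_pdivrMl//.
  apply: (@discrete_maximal_le_continuous _ _ _ bodyG d_gt0 f g a 1) => //.
  - by move=> z; rewrite /g mulrA divff// mul1r.
  - move=> z; rewrite /g mulr_ge0 ?normc_ge0 ?invr_ge0//=.
    by rewrite ler_pdivrMl// mulr1.
have opF : ('N[lebesgue_rV d]_(p%:E)[continuous_maximal G F] <= maximal_opnorm G p)%E.
  by apply: ereal_sup_ubound; exists F.
have KD : ((expR 6 * a)^-1%:E * ell_norm p D <= maximal_opnorm G p)%E.
  rewrite -ell_normZ ?invr_ge0 ?(ltW K0)// -Lnorm_comp_lround.
  apply: le_trans opF; apply: ge0_le_Lnorm => // u.
  by rewrite mule_ge0 ?lee_fin ?invr_ge0 ?(ltW K0).
by rewrite lee_pdivrMl// in KD; rewrite muleAC -EFinM.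
Qed.
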